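(* Let $J,A$ be sets. There is a structurally recursive function assigning to every $\vec u:\mathsf{List}(J)$ and every $\mathfrak a:\mathcal{E}(\mathbb{N},J,A)$ an element $\mathsf{norm}_{\vec u}(\mathfrak a):\mathcal{B}(J,A)$ such that, for all $\vec u:\mathsf{List}(J)$ and $\mathfrak a:\mathcal{E}(\mathbb{N},J,A)$, the relation $\vec u\Vdash\mathfrak a\Downarrow\mathsf{norm}_{\vec u}(\mathfrak a)$ holds.
   Context: Setting: constructive metatheory with function extensionality. $\mathsf{List}(J)$: finite lists; $[\,]$ the empty list; $j::\vec v$ has head $j$ and tail $\vec v$; $\vec u\cdot j$ is $\vec u$ with $j$ appended at the end. Escardó dialogues. For sets $I,J,A$, $\mathcal{E}(I,J,A)$ is the inductive set with constructors $\mathsf{ret}(a)$ for $a:A$, and $\mathsf{query}(i,\mathfrak a)$ for $i:I$ and $\mathfrak a:J\to\mathcal{E}(I,J,A)$. Brouwerian dialogues. For sets $J,A$, $\mathcal{B}(J,A)$ is the inductive set with constructors $\mathsf{spit}(a)$ for $a:A$, and $\mathsf{bite}(\mathbf a)$ for $\mathbf a:J\to\mathcal{B}(J,A)$. Normalization relations. Two relations are defined by mutual induction: $\vec u\Vdash\mathfrak a\Downarrow\mathbf a$ (with $\vec u:\mathsf{List}(J)$, $\mathfrak a:\mathcal{E}(\mathbb{N},J,A)$, $\mathbf a:\mathcal{B}(J,A)$), and $\vec u\Vdash\langle i,\mathfrak a\rangle;\vec v\Downarrow\mathbf a$ (with $\vec u,\vec v:\mathsf{List}(J)$, $i:\mathbb{N}$,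 $\mathfrak a:J\to\mathcal{E}(\mathbb{N},J,A)$, $\mathbf a:\mathcal{B}(J,A)$), generated by the rules: 1. $\vec u\Vdash\mathsf{ret}(a)\Downarrow\mathsf{spit}(a)$. 2. If $\vec u\Vdash\langle i,\mathfrak a\rangle;\vec u\Downarrow\mathbf a$, then $\vec u\Vdash\mathsf{query}(i,\mathfrak a)\Downarrow\mathbf a$. 3. If $\vec u\Vdash\mathfrak a(j)\Downarrow\mathbf a$, then $\vec u\Vdash\langle 0,\mathfrak a\rangle;(j::\vec v)\Downarrow\mathbf a$. 4. If $\vec u\Vdash\langle i,\mathfrak a\rangle;\vec v\Downarrow\mathbf a$, then $\vec u\Vdash\langle i+1,\mathfrak a\rangle;(j::\vec v)\Downarrow\mathbf a$. 5. If for all $j:J$, $\vec u\cdot j\Vdash\mathfrak a(j)\Downarrow\mathbf a(j)$, then $\vec u\Vdash\langle 0,\mathfrak a\rangle;[\,]\Downarrow\mathsf{bite}(\mathbf a)$. 6. If for all $j:J$, $\vec u\cdot j\Vdash\langle i,\mathfrak a\rangle;[\,]\Downarrow\mathbf a(j)$, then $\vec u\Vdash\langle i+1,\mathfrak a\rangle;[\,]\Downarrow\mathsf{bite}(\mathbf a)$. *)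

(* Defs.v *)
From Stdlib Require Import List.
Import ListNotations.

Set Implicit Arguments.

Inductive escardo (I J A : Type) : Type :=
| ret (a : A)
| query (i : I) (k : J -> escardo I J A).

Inductive brouwer (J A : Type) : Type :=
| spit (a : A)
| bite (b : J -> brouwer J A).

Arguments ret {I J A} a.
Arguments query {I J A} i k.
Arguments spit {J A} a.
Arguments bite {J A} b.

(* [normalizes u d b] is u ⊩ d ⇓ b; [normalizes_at u i k v b] is
   u ⊩ ⟨i, k⟩; v ⇓ b. *)
Inductive normalizes (J A : Type) :
    list J -> escardo nat J A -> brouwer J A -> Prop :=
| norm_ret (u : list J) (a : A) :
    normalizes u (ret a) (spit a)
| norm_query (u : list J) (i : nat) (k : J -> escardo nat J A)
    (b : brouwer J A) :
    normalizes_at u i k u b ->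
    normalizes u (query i k) b
with normalizes_at (J A : Type) :
    list J -> nat -> (J -> escardo nat J A) -> list J -> brouwer J A -> Prop :=
| norm_at_zero_cons (u : list J) (k : J -> escardo nat J A)
    (j : J) (v : list J) (b : brouwer J A) :
    normalizes u (k j) b ->
    normalizes_at u 0 k (j :: v) b
| norm_at_succ_cons (u : list J) (i : nat) (k : J -> escardo nat J A)
    (j : J) (v : list J) (b : brouwer J A) :
    normalizes_at u i k v b ->
    normalizes_at u (S i) k (j :: v) b
| norm_at_zero_nil (u : list J) (k : J -> escardo nat J A)
    (b : J -> brouwer J A) :
    (forall j : J, normalizes (u ++ [j]) (k j) (b j)) ->
    normalizes_at u 0 k [] (bite b)
| norm_at_succ_nil (u : list J) (i : nat) (k : J -> escardo nat J A)
    (b : J -> brouwer J A) :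
    (forall j : J, normalizes_at (u ++ [j]) i k [] (b j)) ->
    normalizes_at u (S i) k [] (bite b).

Fixpoint escardo_fold (I J A X : Type) (f : A -> X) (g : I -> (J -> X) -> X)
    (d : escardo I J A) : X :=
  match d with
  | ret a => f a
  | query i k => g i (fun j => escardo_fold f g (k j))
  end.

(* The list parameter may change in recursive calls, so the fold has the
   function space [list J -> X] as its carrier. The step [g] receives only the
   values at the immediate subtrees and not the subtrees themselves: otherwise
   every function would qualify, by taking [g] to ignore the recursive values. *)
Definition structurally_recursive (I J A X : Type)
    (h : list J -> escardo I J A -> X) : Prop :=
  exists (f : A -> list J -> X)
         (g : I -> (J -> list J -> X) -> list J -> X),
    forall (u : list J) (d : escardo I J A), h u d = escardo_fold f g d u.

(* Main.v *)
Require Import Defs.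
From Stdlib Require Import List.
Import ListNotations.

(** The rules are syntax-directed, so they can be read as a program: a fold over the dialogue with
    carrier [list J -> brouwer J A]. A query looks up its answer in the known prefix; past its end,
    each missing answer is bitten and appended. Soundness is induction on the dialogue, with
    [norm_at_normalizes] at each query. *)

(* [v] is the part of the known prefix [u] that has not yet been skipped in
   search of the answer to query [i]. *)
Fixpoint norm_at (J A : Type) (i : nat) (r : J -> list J -> brouwer J A)
    (u v : list J) : brouwer J A :=
  match i, v with
  | 0, j :: _ => r j u
  | S i, _ :: v => norm_at J A i r u v
  | 0, [] => bite (fun j => r j (u ++ [j]))
  | S i, [] => bite (fun j => norm_at J A i r (u ++ [j]) [])
  end.

Lemma norm_at_normalizes (J A : Type) (k : J -> escardo nat J A)
    (r : J -> list J -> brouwer J A) :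
  (forall (j : J) (u : list J), normalizes u (k j) (r j u)) ->
  forall (i : nat) (u v : list J), normalizes_at u i k v (norm_at J A i r u v).
Proof.
  intros Hr i.
  (* The shapes of [i] and [v] select exactly one rule; [u] stays general since a bite extends
     it. *)
  induction i as [|i IH]; intros u [|j v]; simpl; constructor; auto.
Qed.

Theorem corollary3p3 (J A : Type) :
  { norm : list J -> escardo nat J A -> brouwer J A |
    structurally_recursive norm /\
    forall (u : list J) (d : escardo nat J A), normalizes u d (norm u d) }.
Proof.
  set (f := fun (a : A) (_ : list J) => @spit J A a).
  set (g := fun i r (u : list J) => norm_at J A i r u u).
  exists (fun u d => escardo_fold f g d u).
  split.
  - exists f, g. reflexivity.
  - intros u d. revert u.
    induction d as [a|i k IH]; intros u; simpl; constructor.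
    apply norm_at_normalizes. exact IH.
Qed.
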